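(* Let $t\ge1$ and let $q_1,q_2,\dots,q_{2t}$ be distinct primes with $q_i\equiv 3\pmod 4$ for all $i$. Then the field $L=\mathbb{Q}(\sqrt{q_1q_2},\sqrt{q_3q_4},\dots,\sqrt{q_{2t-1}q_{2t}})$ contains at least $t$ totally positive units that are independent modulo squares in $L$; i.e. the deficiency satisfies $\delta(L)\ge t$.
   Context: For a totally real field $F$ of degree $n$ and $0\neq\alpha\in F$, the signature of $\alpha$ is the vector in $\mathbb{F}_2^n$ whose entry at a real embedding $v$ is $0$ if $v(\alpha)>0$ and $1$ if $v(\alpha)<0$. The signatures of the units of $F$ form a subspace of $\mathbb{F}_2^n$ whose dimension is the unit signature rank of $F$; the deficiency $\delta(F)$ is $n$ minus the unit signature rank, which equals the $\mathbb{F}_2$-rank of the group of totally positive units of $F$ modulo squares of units. *)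

(* Defs.v *)
From HB Require Import structures.
From mathcomp Require Import all_boot all_order all_algebra.
From mathcomp Require Import all_field.
Set Implicit Arguments. Unset Strict Implicit. Unset Printing Implicit Defensive.
Import Order.TTheory GRing.Theory Num.Theory.
Local Open Scope ring_scope.

(* Number fields are realised as subfields of algC (algebraic closure of Q). *)

Definition in_gen_field (s : seq algC) (x : algC) : Prop :=
  forall S : {pred algC}, divring_closed S -> {subset s <= S} -> x \in S.

Definition is_unit_of (K : algC -> Prop) (u : algC) : Prop :=
  [/\ K u, u \in Aint, u != 0 & u^-1 \in Aint].

(* totally positive: positive under every embedding into C; embeddings of a
   number field in algC are exactly restrictions of automorphisms of algC. *)
Definition totally_positive (u : algC) : Prop :=
  forall nu : {rmorphism algC -> algC}, 0 < nu u.

Definition is_square_in (K : algC -> Prop) (x : algC) : Prop :=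
  exists2 y, K y & x = y ^+ 2.

(* generators sqrt(q_{2i} q_{2i+1}), i < t  (0-based indexing of the q's) *)
Definition sqrt_gens (q : nat -> nat) (t : nat) : seq algC :=
  [seq sqrtC ((q i.*2 * q i.*2.+1)%N%:R) | i <- iota 0 t].

(* Main.v *)
(* For primes p, q = 3 mod 4, the quadratic field of sqrt(pq) contains the square
   of a unit a sqrt(p) + b sqrt(q): in a solution x = 2k + 1, y = 2z of
   x^2 - pq y^2 = 1 one has k (k + 1) = pq z^2, so k and k + 1 are squares up to
   complementary factors of pq.  The splitting {1, pq} is impossible modulo p or
   gives a smaller solution, and the splitting {p, q} gives p a^2 - q b^2 = 1 or -1.
   These squares are totally positive.  If a product of them over S were a square
   in L, then the product of the sqrt(p_i), i in S, would lie in L; since L is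
   generated by the sqrt(p_j q_j), the product of the p_i (i in S) and of some of
   the p_j q_j would be a perfect square, which the valuations at p_i and q_i for
   one i in S rule out. *)

Require Import Defs.
From HB Require Import structures.
From mathcomp Require Import all_boot all_order all_algebra all_field.
From mathcomp Require Import cyclic boolp zify ring.
Import Order.TTheory GRing.Theory Num.Theory.
Local Open Scope ring_scope.

(** * Pell's equation *)

(* The triple (a, h, e) encodes the form [a X^2 + 2 h X Y - e Y^2].  With a, e > 0
   and h^2 + a e = D it is an edge of Conway's river of the discriminant 4 D;
   [river_step] replaces a basis (u, w) by (u + w, w) or (u, u + w), according to
   the sign of the form at u + w. *)
Definition river_step (s : int * int * int) : int * int * int :=
  let: (a, h, e) := s in
  let b := a + 2 * h - e in
  if 0 < b then (b, h - e, e) else (a, h + a, - b).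

Definition on_river (D : nat) (s : int * int * int) : bool :=
  let: (a, h, e) := s in [&& 0 < a, 0 < e & h ^+ 2 + a * e == D%:Z].

(** The value [b] at u + w is nonzero, since [b = 0] would make D the square of a + h. *)
Lemma on_river_step (D : nat) (s : int * int * int) :
  (forall m, (m ^ 2)%N <> D) -> on_river D s -> on_river D (river_step s).
Proof.
move=> nsq; case: s => [[a h] e] /and3P[a0 e0 /eqP hD] /=.
have b0 : a + 2 * h - e != 0.
  apply/eqP => b0; apply: (nsq `|(a + h)%R|%N).
  have eE : e = a + 2 * h by lia.
  apply/eqP; rewrite -eqz_nat -hD eE -abszX; apply/eqP.
  by rewrite gez0_abs ?sqr_ge0 //; ring.
by case: ifP => hb; apply/and3P; split; try lia; apply/eqP; rewrite -hD; ring.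
Qed.

(** At the difference of the new basis vectors the form takes the value a > 0 after the first branch
    and -e < 0 after the second, so the result reveals the branch, and each branch is invertible. *)
Lemma river_step_inj (D : nat) :
  {in on_river D &, injective river_step}.
Proof.
move=> [[a h] e] [[a' h'] e'] /and3P[a0 e0 _] /and3P[a0' e0' _] /=.
by do 2![case: ifP => ?] => -[? ? ?]; do ?[congr pair]; lia.
Qed.

(* There are finitely many edges and [river_step] is injective on them. *)
Lemma river_period (D : nat) (s : int * int * int) :
    (forall m, (m ^ 2)%N <> D) -> on_river D s ->
  exists2 n, (0 < n)%N & iter n river_step s = s.
Proof.
move=> nsq sD.
have itD n : on_river D (iter n river_step s).
  by elim: n => // n IH; exact: on_river_step.
have back i n : iter (i + n) river_step s = iter i river_step s ->
    iter n river_step s = s.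
  elim: i => // i IH /= E; apply: IH; apply: river_step_inj E; exact: itD.
pose T := ('I_D.+1 * bool * 'I_D.+1 * 'I_D.+1)%type.
(* On the river all entries are at most D in absolute value, so [inord] loses nothing; the boolean
   keeps the sign of h. *)
pose code (s : int * int * int) : T :=
  (inord `|s.1.1|, 0 <= s.1.2, inord `|s.1.2|, inord `|s.2|).
have code_inj : {in on_river D &, injective code}.
  move=> [[a h] e] [[a' h'] e'] /and3P[a0 e0 /eqP aD] /and3P[a0' e0' /eqP aD'].
  case=> /(congr1 val) + sh /(congr1 val) + /(congr1 val).
  rewrite /= !inordK ?ltnS; try nia.
  by move=> *; do ?[congr pair]; lia.
pose f (i : 'I_#|{: T}|.+1) := code (iter i river_step s).
have /injectivePn [i [j ij fij]] : ~~ injectiveb f.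
  by apply/negP => /injectiveP /leq_card; rewrite card_ord ltnn.
wlog ltij : i j ij fij / (i < j)%N.
  move=> W; case: (ltngtP i j) => // [|ji|/val_inj E]; first exact: W.
  - by apply: (W j i); rewrite 1?eq_sym.
  - by rewrite E eqxx in ij.
exists (j - i)%N; first by rewrite subn_gt0.
apply: (back i); rewrite subnKC ?(ltnW ltij) //.
by apply/esym/code_inj => //; exact: itD.
Qed.

(** After n steps the triple describes X^2 - D Y^2 in the basis (x, y), (z, w). The coordinate sum
    grows at each step, so the basis never recurs, although the triple does. *)
Lemma river_basis (D n : nat) :
  exists x y z w : nat,
    [/\ iter n river_step (1, 0, D%:Z) =
          (x%:Z ^+ 2 - D%:Z * y%:Z ^+ 2, x%:Z * z%:Z - D%:Z * y%:Z * w%:Z,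
           D%:Z * w%:Z ^+ 2 - z%:Z ^+ 2),
        (0 < x + y)%N, (0 < z + w)%N & (n.+2 <= x + y + (z + w))%N].
Proof.
elim: n => [|n [x [y [z [w [E xy zw le]]]]]].
  by exists 1%N, 0%N, 0%N, 1%N; split => //=; do ?[congr pair]; ring.
rewrite iterS E /river_step; case: ifP => _.
  by exists (x + z)%N, (y + w)%N, z, w; split; try lia;
    do ?[congr pair]; rewrite ?PoszD; ring.
by exists x, y, (x + z)%N, (y + w)%N; split; try lia;
  do ?[congr pair]; rewrite ?PoszD; ring.
Qed.

Lemma Pell (D : nat) : (forall m, (m ^ 2)%N <> D) ->
  exists x y : nat, (0 < y)%N /\ (x ^ 2 = D * y ^ 2 + 1)%N.
Proof.
move=> nsq.
have D0 : (0 < D)%N by case: D nsq => // /(_ 0%N).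
have [|n n0] := @river_period D (1, 0, D%:Z) nsq.
  by apply/and3P; split => //; apply/eqP; ring.
have [x [y [z [w [-> xy zw le]]]]] := river_basis D n.
case=> E1 E2 E3; exists x, y; split; last by nia.
(* With y = 0 the basis would be the initial one, of coordinate sum 2, which is too small after n >
   0 steps. *)
rewrite lt0n; apply/eqP => y0; subst y.
have x1 : x = 1%N by nia.
subst x.
have z0 : z = 0%N by nia.
subst z.
have w1 : w = 1%N by nia.
lia.
Qed.

(** * The equation [p a^2 - q b^2 = 1] or [-1] *)

(** Cancelling d = gcd(m, z) leaves m' n = d z'^2; by coprimality m' and d divide each other, so m =
    d^2. *)
Lemma coprime_mul_sqr (m n z : nat) :
  (m * n = z ^ 2)%N -> coprime m n -> exists a, m = (a ^ 2)%N.
Proof.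
case: (posnP m) => [-> _ _|m0 mn cmn]; first by exists 0%N.
set d := gcdn m z; have d0 : (0 < d)%N by rewrite gcdn_gt0 m0.
have [m' mE] : exists m', m = (m' * d)%N by apply/dvdnP/dvdn_gcdl.
have [z' zE] : exists z', z = (z' * d)%N by apply/dvdnP/dvdn_gcdr.
have cmz : coprime m' z'.
  by rewrite /coprime -(eqn_pmul2r d0) muln_gcdl -mE -zE mul1n.
have E : (m' * n = d * z' ^ 2)%N.
  by apply/eqP; rewrite -(eqn_pmul2l d0); apply/eqP; move: mn; rewrite {1}mE zE; lia.
have cdn : coprime d n by apply: coprime_dvdl cmn; apply: dvdn_gcdl.
have md : (m' %| d)%N by rewrite -(@Gauss_dvdl _ _ (z' ^ 2)) ?coprimeXr // -E dvdn_mulr.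
have dm : (d %| m')%N by rewrite -(@Gauss_dvdl _ _ n) // E dvdn_mulr.
have : m' = d by apply/eqP; rewrite eqn_dvd md.
by exists d; rewrite mE; nia.
Qed.

(** If a^2 is -1 modulo p, then, (p - 1)/2 being odd, Fermat's theorem yields that a^2 is also 1,
    whence p divides 2. *)
Lemma dvd_sqrDn1 (p a : nat) : prime p -> (p %% 4 = 3)%N -> ~~ (p %| a ^ 2 + 1)%N.
Proof.
move=> pp p3; apply/negP => pa.
have pna : coprime a p.
  rewrite coprime_sym prime_coprime //; apply/negP => pda.
  by move: pa; rewrite dvdn_addr ?Euclid_dvd1 // dvdn_mulr.
have := Euler_exp_totient pna; rewrite totient_prime //.
have -> : (p.-1 = 2 * (2 * (p %/ 4) + 1))%N by lia.
rewrite expnM; set b := (a ^ 2)%N in pa *; rewrite addn1 expnS expnM.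
have b1 : (b ^ 2 = 1 %[mod p])%N.
  have b0 : (0 < b)%N.
    by case: (posnP b) pa => // ->; rewrite dvdn1 => /eqP p1; rewrite p1 in p3.
  apply/eqP; rewrite eqn_mod_dvd; last by rewrite expn_gt0 b0.
  by rewrite -{2}(exp1n 2) subn_sqr dvdn_mull.
rewrite -modnMmr -modnXm b1 modnXm exp1n modnMmr muln1 => bp.
have : (p %| 2)%N.
  by rewrite /dvdn -[2%N]/(1 + 1)%N -modnDml -bp modnDml; exact: pa.
by rewrite dvdn_prime2 // => /eqP p2; rewrite p2 in p3.
Qed.

Lemma prime_mul_nonsquare (p m n : nat) : prime p -> ~~ (p %| m)%N -> (p * m)%N <> (n ^ 2)%N.
Proof.
move=> pp pm E.
have m0 : (0 < m)%N by case: m pm {E} => //; rewrite dvdn0.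
have : odd (logn p (p * m)) = odd (logn p (n ^ 2)) by rewrite E.
rewrite lognX oddM (lognM p (prime_gt0 pp) m0) logn_prime // eqxx.
by rewrite (lognE p m) (negbTE pm) !andbF.
Qed.

Lemma norm_one_3mod4 (p q : nat) :
    prime p -> prime q -> (p %% 4 = 3)%N -> (q %% 4 = 3)%N -> p != q ->
  exists a b : nat, (p * a ^ 2 = q * b ^ 2 + 1 \/ q * b ^ 2 = p * a ^ 2 + 1)%N.
Proof.
move=> pp qp p3 q3 pq.
have npq : ~~ (p %| q)%N by rewrite dvdn_prime2.
have [x [y]] := @Pell (p * q)%N (fun m E => prime_mul_nonsquare p q m pp npq (esym E)).
(* As p q is 1 modulo 4, x must be odd and y even. *)
have [d dE] : exists d, (p * q = 4 * d + 1)%N.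
  by exists (p * q %/ 4)%N; rewrite [LHS](divn_eq _ 4) -modnMm p3 q3 mulnC.
elim/ltn_ind: y x => y IH x [y0 xy].
have [k xE] : exists k, (x = 2 * k + 1)%N.
  exists x./2; rewrite -[LHS]odd_double_half; case ox: (odd x); first lia.
  exfalso; move: xy; rewrite dE -(odd_double_half x) -(odd_double_half y) ox.
  by case: (odd y); nia.
have [z yE] : exists z, (y = 2 * z)%N.
  exists y./2; rewrite -[LHS]odd_double_half; case oy: (odd y); last lia.
  exfalso; move: xy; rewrite dE xE -(odd_double_half y) oy; nia.
have z0 : (0 < z)%N by lia.
have kz : (k * (k + 1) = p * q * z ^ 2)%N by nia.
have ck : coprime k (k + 1) by rewrite addn1 coprimenS.
have [p0 q0] := (prime_gt0 pp, prime_gt0 qp).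
have pqC : coprime p q by rewrite prime_coprime.
have : (p %| k * (k + 1))%N by rewrite kz -mulnA dvdn_mulr.
have : (q %| k * (k + 1))%N by rewrite kz -mulnA mulnCA dvdn_mulr.
rewrite !Euclid_dvdM //.
(* Here r and s are the parts of p q dividing k and k + 1; the cofactors are coprime with product
   z^2. *)
have sqs m n r s : (r * s = p * q)%N -> k = (m * r)%N -> (k + 1 = n * s)%N ->
    exists a b, [/\ m = (a ^ 2)%N, n = (b ^ 2)%N & (a * b = z)%N].
  move=> rs mE nE; move: ck; rewrite nE mE coprimeMl !coprimeMr.
  move=> /andP[/andP[c _] _].
  have mn : (m * n = z ^ 2)%N.
    apply/eqP; rewrite -(@eqn_pmul2l (p * q)) ?muln_gt0 ?p0 // -kz nE mE -rs.
    by rewrite [(m * n)%N]mulnC; apply/eqP; lia.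
  have [a aE] := coprime_mul_sqr _ _ _ mn c.
  have [b bE] : exists b, n = (b ^ 2)%N.
    by apply: (coprime_mul_sqr n m z); rewrite 1?mulnC 1?coprime_sym.
  by exists a, b; split=> //; apply/eqP; rewrite -eqn_sqr expnMn -aE -bE mn.
case/orP=> qd; case/orP=> pd.
(* Now b^2 = p q a^2 + 1 with a < 2 a b = y: the descent. *)
- have /dvdnP[m mE] : (p * q %| k)%N by rewrite Gauss_dvd ?pd.
  have [a [b [aE bE abz]]] := sqs m (k + 1)%N _ 1%N (muln1 _) mE (esym (muln1 _)).
  have [a0 b0] : (0 < a)%N /\ (0 < b)%N by apply/andP; rewrite -muln_gt0 abz.
  apply: (IH a _ b); last by rewrite -bE mE aE mulnC.
  by rewrite yE -abz mulnCA ltn_Pmulr // leq_pmulr.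
- have [m mE] := dvdnP qd; have [n nE] := dvdnP pd.
  have [a [b [aE bE _]]] := sqs m n q p (mulnC _ _) mE nE.
  by exists b, a; left; rewrite mulnC -bE -nE mE aE [(q * _)%N]mulnC.
- have [m mE] := dvdnP pd; have [n nE] := dvdnP qd.
  have [a [b [aE bE _]]] := sqs m n p q erefl mE nE.
  by exists a, b; right; rewrite mulnC -bE -nE mE aE [(p * _)%N]mulnC.
- have /dvdnP[n nE] : (p * q %| k + 1)%N by rewrite Gauss_dvd ?pd.
  have [a [b [aE _ _]]] := sqs k n 1%N _ (mul1n _) (esym (muln1 k)) nE.
  by case/negP: (dvd_sqrDn1 p a pp p3); rewrite -aE nE mulnCA dvdn_mulr.
Qed.

(** * Multiquadratic fields *)

(** Made boolean classically, so that it can carry the subfield structure behind the [rpred]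
    lemmas. *)
Definition gen_field (s : seq algC) : {pred algC} := fun x => `[< in_gen_field s x >].

Lemma gen_fieldP (s : seq algC) (x : algC) :
  reflect (in_gen_field s x) (x \in gen_field s).
Proof. exact: asboolP. Qed.

Lemma gen_field_closed (s : seq algC) : divring_closed (gen_field s).
Proof.
split=> [|x y /gen_fieldP sx /gen_fieldP sy|x y /gen_fieldP sx /gen_fieldP sy].
- by apply/gen_fieldP => S [].
- by apply/gen_fieldP => S cS sS; have [_ + _] := cS; apply; [exact: sx | exact: sy].
- by apply/gen_fieldP => S cS sS; have [_ _ +] := cS; apply; [exact: sx | exact: sy].
Qed.

HB.instance Definition _ (s : seq algC) :=
  GRing.isDivringClosed.Build algC (gen_field s) (gen_field_closed s).

Lemma mem_gen_field (s : seq algC) : {subset s <= gen_field s}.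
Proof. by move=> x xs; apply/gen_fieldP => S _; apply. Qed.

Lemma gen_field_sub (s : seq algC) (S : {pred algC}) :
  divring_closed S -> {subset s <= S} -> {subset gen_field s <= S}.
Proof. by move=> cS sS x /gen_fieldP; apply. Qed.

Lemma Crat_gen_field (s : seq algC) : {subset Crat <= gen_field s}.
Proof.
by move=> _ /CratP[a ->]; rewrite rpred_div ?rpred_int.
Qed.

Lemma gen_field_consP (g : algC) (s : seq algC) (x : algC) :
    g ^+ 2 \in gen_field s -> x \in gen_field (g :: s) ->
  exists a b, [/\ a \in gen_field s, b \in gen_field s & x = a + b * g].
Proof.
set K := gen_field s => g2.
pose S : {pred algC} :=
  fun x => `[< exists a b, [/\ a \in K, b \in K & x = a + b * g] >].
have SP y : reflect (exists a b, [/\ a \in K, b \in K & y = a + b * g]) (y \in S).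
  exact: asboolP.
have SK : {subset K <= S}.
  by move=> y yK; apply/SP; exists y, 0; rewrite rpred0 mul0r addr0.
have [G GE GK] : exists2 G, g ^+ 2 = G & G \in K by exists (g ^+ 2).
have SM : {in S &, forall y z, y * z \in S}.
  move=> _ _ /SP[a [b [aK bK ->]]] /SP[c [d [cK dK ->]]]; apply/SP.
  exists (a * c + b * d * G), (a * d + b * c).
  by split; [rewrite rpredD ?rpredM | rewrite rpredD ?rpredM | rewrite -GE; ring].
have SV : {in S, forall y, y^-1 \in S}.
  move=> y /SP[a [b [aK bK ->]]].
  have [gK|gK] := boolP (g \in K).
    by apply: SK; rewrite rpredV rpredD ?rpredM.
  have [b0|b0] := eqVneq b 0.
    by apply: SK; rewrite b0 mul0r addr0 rpredV.
  (* Applied to a and -a, this makes the norm a^2 - b^2 g^2 nonzero, so the conjugate gives the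
     inverse. *)
  have n0 (c : algC) : c \in K -> c + b * g != 0.
    move=> cK; apply: contraNneq gK => /eqP; rewrite addrC addr_eq0 => /eqP E.
    by rewrite -(mulKf b0 g) E rpredM ?rpredV ?rpredN.
  have nN : a ^+ 2 - b ^+ 2 * G \in K.
    by rewrite rpredB ?rpredX // rpredM ?rpredX.
  apply/SP; exists (a / (a ^+ 2 - b ^+ 2 * G)), (- b / (a ^+ 2 - b ^+ 2 * G)).
  split; rewrite ?rpredM ?rpredV ?rpredN //.
  have nK : - a \in K by rewrite rpredN.
  have := n0 _ nK; have := n0 _ aK => p0 m0.
  have d0 : a ^+ 2 - b ^+ 2 * G != 0.
    have -> : a ^+ 2 - b ^+ 2 * G = - ((a + b * g) * (- a + b * g)).
      by rewrite -GE; ring.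
    by rewrite oppr_eq0 mulf_neq0.
  by rewrite -GE in d0 *; field; rewrite exprMn d0 p0.
have cS : divring_closed S.
  split=> [|_ _ /SP[a [b [aK bK ->]]] /SP[c [d [cK dK ->]]]|y z yS zS].
  - by apply: SK; exact: rpred1.
  - by apply/SP; exists (a - c), (b - d); split; rewrite ?rpredB //; ring.
  - by apply: SM => //; apply: SV.
move/(gen_field_sub _ _ cS) => xS; apply/SP/xS => y.
rewrite inE => /predU1P[->|ys]; last exact/SK/mem_gen_field.
by apply/SP; exists 0, 1; rewrite rpred0 rpred1 add0r mul1r.
Qed.

(* Expanding the square of [x = a + b * g] shows that [a * b = 0] unless [g]
   already lies in the smaller field. *)
Lemma multiquadratic_sqrt (I : eqType) (g : I -> algC) (r : seq I) (x : algC) :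
    (forall i, i \in r -> g i ^+ 2 \in Crat) ->
    x ^+ 2 \in Crat -> x \in gen_field [seq g i | i <- r] ->
  exists2 r', subseq r' r & x * \prod_(i <- r') g i \in Crat.
Proof.
elim: r x => [|i r IH] x gr x2 /=.
  move=> xK; exists [::] => //; rewrite big_nil mulr1.
  exact: gen_field_sub Crat_divring_closed _ _ xK.
have {}IH y := IH y (fun j jr => gr j (mem_behead (s := i :: r) jr)).
have g2 := gr i (mem_head i r).
set K := gen_field [seq g j | j <- r] in IH *.
have QK : {subset Crat <= K} by exact: Crat_gen_field.
case/gen_field_consP => [|a [b [aK bK xE]]]; first exact: QK.
have small : x \in K ->
    exists2 r', subseq r' (i :: r) & x * \prod_(i <- r') g i \in Crat.
  by case/IH => // r' r'r xr'; exists r' => //;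
    apply: subseq_trans r'r (subseq_cons _ _).
have [gK|gK] := boolP (g i \in K); first by apply: small; rewrite xE rpredD ?rpredM.
have [b0|b0] := eqVneq b 0; first by apply: small; rewrite xE b0 mul0r addr0.
have [a0|a0] := eqVneq a 0.
  (* Here x = b g, so x g = b g^2 lies in the smaller field. *)
  case: (IH (x * g i)) => [||r' r'r xr'].
  - by rewrite exprMn rpredM.
  - by rewrite xE a0 add0r -mulrA -expr2 rpredM // QK.
  - by exists (i :: r'); rewrite ?big_cons ?mulrA //= eqxx.
case/negP: gK.
have -> : g i = (x ^+ 2 - a ^+ 2 - b ^+ 2 * g i ^+ 2) / (2 * a * b).
  by rewrite xE; field; rewrite a0 b0.
apply: rpred_div; last by rewrite !rpredM ?rpred_nat.
apply: rpredB; first by apply: rpredB; [exact: QK | exact: rpredX].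
by apply: rpredM; [exact: rpredX | exact: QK].
Qed.

(** * The units *)

Lemma sqrtC_nat_Aint (n : nat) : sqrtC n%:R \in Aint.
Proof.
apply: (@root_monic_Aint ('X^2 - n%:R%:P)).
- by rewrite /root !hornerE sqrtCK subrr.
- exact: monicXnsubC.
- by rewrite polyOverXnsubC rpred_nat.
Qed.

Lemma sqrtC_natM (m n : nat) : sqrtC (m * n)%:R = sqrtC m%:R * sqrtC n%:R :> algC.
Proof. by rewrite natrM sqrtCM ?nnegrE ?ler0n. Qed.

Definition root_unit (p q a b : nat) : algC :=
  a%:R * sqrtC p%:R + b%:R * sqrtC q%:R.

Definition conj_unit (p q a b : nat) : algC :=
  a%:R * sqrtC p%:R - b%:R * sqrtC q%:R.

(** The unsquared product is p a^2 - q b^2, which is 1 or -1; squaring removes the sign. *)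
Lemma root_unitM (p q a b : nat) :
    (p * a ^ 2 = q * b ^ 2 + 1 \/ q * b ^ 2 = p * a ^ 2 + 1)%N ->
  root_unit p q a b ^+ 2 * conj_unit p q a b ^+ 2 = 1.
Proof.
move=> ab.
have -> : root_unit p q a b ^+ 2 * conj_unit p q a b ^+ 2 =
    (a%:R ^+ 2 * sqrtC p%:R ^+ 2 - b%:R ^+ 2 * sqrtC q%:R ^+ 2) ^+ 2.
  by rewrite /root_unit /conj_unit; ring.
rewrite !sqrtCK -!natrX -!natrM ![(_ ^ 2 * _)%N]mulnC.
by case: ab => ->; rewrite natrD; ring.
Qed.

Lemma root_unit_neq0 (p q a b : nat) :
    (p * a ^ 2 = q * b ^ 2 + 1 \/ q * b ^ 2 = p * a ^ 2 + 1)%N ->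
  root_unit p q a b != 0.
Proof.
move=> ab; apply/eqP => u0; move/eqP: (root_unitM _ _ _ _ ab).
by rewrite u0 expr0n mul0r eq_sym oner_eq0.
Qed.

Lemma root_unit_isunit (p q a b : nat) (K : divringClosed algC) :
    (p * a ^ 2 = q * b ^ 2 + 1 \/ q * b ^ 2 = p * a ^ 2 + 1)%N ->
    sqrtC (p * q)%:R \in K ->
  is_unit_of (fun x => x \in K) (root_unit p q a b ^+ 2).
Proof.
have A n c : c%:R * sqrtC n%:R \in Aint by rewrite rpredM ?rpred_nat ?sqrtC_nat_Aint.
move=> ab pqK; have u0 := root_unit_neq0 _ _ _ _ ab; split.
- have -> : root_unit p q a b ^+ 2 =
      (p * a ^ 2 + q * b ^ 2)%:R + (2 * a * b)%:R * sqrtC (p * q)%:R.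
    rewrite sqrtC_natM natrD !(natrM _ _ (_ ^ _)) !natrX !natrM.
    by rewrite -{1}(sqrtCK p%:R) -{1}(sqrtCK q%:R) /root_unit; ring.
  by rewrite rpredD ?rpredM ?rpred_nat.
- by rewrite rpredX ?rpredD.
- by rewrite expf_neq0.
- have -> : (root_unit p q a b ^+ 2)^-1 = conj_unit p q a b ^+ 2.
    by rewrite -[LHS]mulr1 -(root_unitM _ _ _ _ ab) mulKf // expf_neq0.
  by rewrite rpredX ?rpredB.
Qed.

(** Every embedding sends the root of a natural number to plus or minus itself, so [root_unit] goes
    to a nonzero real number. *)
Lemma root_unit_totally_positive (p q a b : nat) :
    (p * a ^ 2 = q * b ^ 2 + 1 \/ q * b ^ 2 = p * a ^ 2 + 1)%N ->
  totally_positive (root_unit p q a b ^+ 2).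
Proof.
move=> ab nu.
rewrite rmorphXn real_exprn_even_gt0 ?fmorph_eq0 ?(root_unit_neq0 _ _ _ _ ab) //.
have R n : nu (sqrtC n%:R) \is Num.real.
  have : nu (sqrtC n%:R) ^+ 2 == sqrtC n%:R ^+ 2.
    by rewrite -rmorphXn sqrtCK rmorph_nat.
  by rewrite eqf_sqr => /pred2P[] ->; rewrite ?realN sqrtC_real ?ler0n.
by rewrite rmorphD !rmorphM !rmorph_nat rpredD ?rpredM ?R ?realn.
Qed.

(** Since sqrt(q) = sqrt(p) sqrt(pq) / p, [root_unit] may be replaced by sqrt(p) modulo factors from
    K. *)
Lemma root_unit_factor (p q a b : nat) (K : divringClosed algC) :
    (0 < p)%N -> sqrtC (p * q)%:R \in K ->
  exists2 c, c \in K & root_unit p q a b = sqrtC p%:R * c.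
Proof.
move=> p0 pqK; exists (a%:R + b%:R * sqrtC (p * q)%:R / p%:R).
  by rewrite rpredD ?rpredM ?rpredV ?rpred_nat.
have sp0 : sqrtC p%:R != 0 :> algC by rewrite sqrtC_eq0 pnatr_eq0 -lt0n.
rewrite sqrtC_natM -{3}(sqrtCK p%:R) /root_unit.
by field.
Qed.

(** * Parity of valuations and independence modulo squares *)

Lemma logn_prod (p : nat) (I : Type) (r : seq I) (P : pred I) (F : I -> nat) :
    (forall i, P i -> 0 < F i)%N ->
  logn p (\prod_(i <- r | P i) F i) = (\sum_(i <- r | P i) logn p (F i))%N.
Proof.
move=> F0; suff [] :
  (logn p (\prod_(i <- r | P i) F i) = \sum_(i <- r | P i) logn p (F i))%N /\
  (0 < \prod_(i <- r | P i) F i)%N by [].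
elim/big_rec2: _ => [|i m n Pi [<- n0]]; first by rewrite logn1.
by rewrite lognM ?muln_gt0 ?F0.
Qed.

(** For i0 in S, the valuations at the even- and odd-indexed primes of pair i0 are 1 + e and e,
    where e is 1 if i0 is in r and 0 otherwise; they cannot both be even. *)
Lemma prime_pairs_nonsquare (t m : nat) (q : nat -> nat)
    (S : {set 'I_t}) (r : seq nat) :
    (forall i, (i < 2 * t)%N -> prime (q i)) ->
    (forall i j, (i < 2 * t)%N -> (j < 2 * t)%N -> q i = q j -> i = j) ->
    subseq r (iota 0 t) -> S != set0 ->
  (\prod_(i in S) q i.*2 * \prod_(i <- r) (q i.*2 * q i.*2.+1) <> m ^ 2)%N.
Proof.
move=> qP qI rt /set0Pn[i0 i0S] E.
have rU : uniq r by apply: subseq_uniq rt (iota_uniq _ _).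
have rlt i : i \in r -> (i < t)%N by move=> /(mem_subseq rt); rewrite mem_iota.
have evP (i : nat) : (i < t)%N -> (i.*2 < 2 * t)%N by lia.
have odP (i : nat) : (i < t)%N -> (i.*2.+1 < 2 * t)%N by lia.
have lt0 := ltn_ord i0.
have lq i j : (i < 2 * t)%N -> (j < 2 * t)%N -> logn (q i) (q j) = (i == j).
  move=> it jt; rewrite logn_prime ?qP //; congr nat_of_bool.
  by apply/eqP/eqP => [|-> //]; exact: qI.
have pS : (0 < \prod_(i in S) q i.*2)%N.
  by apply: prodn_cond_gt0 => i _; rewrite prime_gt0 ?qP ?evP.
have pr : (0 < \prod_(i <- r) (q i.*2 * q i.*2.+1))%N.
  rewrite big_seq; apply: prodn_cond_gt0 => i /rlt it.
  by rewrite muln_gt0 !prime_gt0 ?qP ?evP ?odP.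
have par k : (k < 2 * t)%N ->
    ~~ odd (\sum_(i in S) (k == i.*2) + \sum_(i <- r) ((k == i.*2) + (k == i.*2.+1))).
  move=> kt; have /(congr1 (fun n => odd (logn (q k) n))) := E.
  rewrite lognM // lognX oddM /= big_seq !logn_prod.
  - rewrite -big_seq => /negbT; congr (~~ odd (_ + _)).
      by apply: eq_bigr => i _; rewrite lq ?evP.
    rewrite big_seq [RHS]big_seq; apply: eq_bigr => i /rlt it.
    by rewrite lognM ?prime_gt0 ?qP ?evP ?odP // !lq ?evP ?odP.
  - by move=> i /rlt it; rewrite muln_gt0 !prime_gt0 ?qP ?evP ?odP.
  - by move=> i _; rewrite prime_gt0 ?qP ?evP.
have cr : (\sum_(i <- r) (nat_of_ord i0 == i) = (nat_of_ord i0 \in r))%N.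
  rewrite -count_uniq_mem // -sum1_count [RHS]big_mkcond.
  by apply: eq_bigr => i _; rewrite /= eq_sym; case: eqP.
have := par _ (odP _ lt0); have := par _ (evP _ lt0).
have eo (i j : nat) : (i.*2 == j.*2.+1) = false by apply/eqP; lia.
have oe (i j : nat) : (i.*2.+1 == j.*2) = false by apply/eqP; lia.
have dbl (i j : nat) : (i.*2 == j.*2) = (i == j) by apply/eqP/eqP; lia.
have -> : (\sum_(i in S) (i0.*2.+1 == i.*2) = 0)%N by apply: big1 => i _; rewrite oe.
have -> : (\sum_(i in S) (i0.*2 == i.*2) = 1)%N.
  rewrite (bigD1 i0) //= eqxx big1 // => i /andP[_ ii0].
  by rewrite dbl eq_sym -val_eqE in ii0 *; rewrite (negbTE ii0).
under eq_bigr do rewrite dbl eo addn0; rewrite cr => odd1.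
by under eq_bigr do rewrite oe add0n eqSS dbl; rewrite cr; case: (_ \in r) odd1.
Qed.

Theorem theorem6p11 (t : nat) (q : nat -> nat)
  (ht : (1 <= t)%N)
  (hprime : forall i, (i < 2 * t)%N -> prime (q i))
  (hmod : forall i, (i < 2 * t)%N -> (q i %% 4 = 3)%N)
  (hdist : forall i j, (i < 2 * t)%N -> (j < 2 * t)%N -> q i = q j -> i = j) :
  let L := in_gen_field (sqrt_gens q t) in
  exists u : 'I_t -> algC,
    (forall i, is_unit_of L (u i) /\ totally_positive (u i)) /\
    (forall S : {set 'I_t}, S != set0 ->
       ~ is_square_in L (\prod_(i in S) u i)).
Proof.
move=> L.
pose K := gen_field (sqrt_gens q t).
have ev (i : 'I_t) : (i.*2 < 2 * t)%N by have := ltn_ord i; lia.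
have od (i : 'I_t) : (i.*2.+1 < 2 * t)%N by have := ltn_ord i; lia.
have gK (i : 'I_t) : sqrtC (q i.*2 * q i.*2.+1)%:R \in K.
  apply: mem_gen_field; apply/mapP; exists (val i) => //.
  by rewrite mem_iota /=.
have normE (i : 'I_t) : exists ab : nat * nat,
    (q i.*2 * ab.1 ^ 2 = q i.*2.+1 * ab.2 ^ 2 + 1 \/
     q i.*2.+1 * ab.2 ^ 2 = q i.*2 * ab.1 ^ 2 + 1)%N.
  have [||||| a [b abE]] := @norm_one_3mod4 (q i.*2) (q i.*2.+1);
    rewrite ?hprime ?hmod //.
    by apply/eqP => /hdist E; have := E (ev i) (od i); lia.
  by exists (a, b).
have [ab abE] := fin_all_exists normE.
pose v (i : 'I_t) := root_unit (q i.*2) (q i.*2.+1) (ab i).1 (ab i).2.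
exists (fun i => v i ^+ 2); split=> [i|S S0 [y /gen_fieldP yK vy]].
  split; last exact: root_unit_totally_positive.
  have [/gen_fieldP] := root_unit_isunit _ _ _ _ _ (abE i) (gK i).
  by split.
have /fin_all_exists2[c cK cE] (i : 'I_t) :
    exists2 c, c \in K & v i = sqrtC (q i.*2)%:R * c.
  exact: root_unit_factor (prime_gt0 (hprime _ (ev i))) (gK i).
pose x : algC := \prod_(i in S) sqrtC (q i.*2)%:R.
have xK : x \in K.
  have VK : \prod_(i in S) v i \in K.
    (* The product of the [v i] is y or -y, hence lies in K. *)
    have : (\prod_(i in S) v i) ^+ 2 == y ^+ 2 by rewrite -prodrXl vy.
    by rewrite eqf_sqr => /pred2P[] ->; rewrite ?rpredN.
  have c0 : \prod_(i in S) c i != 0.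
    apply/prodf_neq0 => i _; have := root_unit_neq0 _ _ _ _ (abE i).
    by rewrite -/(v i) cE mulf_eq0 => /norP[].
  have xc : x * \prod_(i in S) c i = \prod_(i in S) v i.
    by rewrite -big_split; apply: eq_bigr => i _; rewrite cE.
  by rewrite -(mulfK c0 x) xc; apply: rpred_div VK _; exact: rpred_prod.
have [|||r rt] :=
  @multiquadratic_sqrt _ (fun i => sqrtC (q i.*2 * q i.*2.+1)%:R) (iota 0 t) x.
- by move=> i _; rewrite sqrtCK rpred_nat.
- by rewrite -prodrXl rpred_prod // => i _; rewrite sqrtCK rpred_nat.
- exact: xK.
set z := x * _ => zQ.
(* A rational algebraic integer is an integer m; its square is the product excluded by parity. *)
have /Cint_rat_Aint : z \in Crat by [].
have zA : z \in Aint by rewrite rpredM ?rpred_prod // => i _; exact: sqrtC_nat_Aint.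
move=> /(_ zA) /intrP[m zm].
apply: (prime_pairs_nonsquare t `|m|%N q S r hprime hdist rt S0).
apply/eqP; rewrite -(eqr_nat algC) natrM !natr_prod natrX natr_absz.
rewrite -rmorphXn /= -normrX ger0_norm ?sqr_ge0 // rmorphXn /= -zm /z exprMn -!prodrXl.
by apply/eqP; congr (_ * _); apply: eq_bigr => i _; rewrite sqrtCK.
Qed.
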